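(* Let $(X,\mathcal{E})$ be a coarse space. If $(X,\mathcal{E})$ has coarse property C, then $(X,\mathcal{E})$ has coarse property A.
   Context: A coarse structure on a set $X$ is a collection $\mathcal{E}$ of subsets of $X\times X$, called entourages (or controlled sets), such that: subsets of entourages are entourages; finite unions of entourages are entourages; the diagonal $\Delta_X=\{(x,x)\mid x\in X\}$ is an entourage; if $E\in\mathcal{E}$ then $E^{-1}=\{(y,x)\mid (x,y)\in E\}\in\mathcal{E}$; if $E_1,E_2\in\mathcal{E}$ then $E_1\circ E_2=\{(x,z)\mid \exists y\in X,\ (x,y)\in E_1,\ (y,z)\in E_2\}\in\mathcal{E}$. The pair $(X,\mathcal{E})$ is a coarse space. For $E\in\mathcal{E}$, a family $\mathcal{U}$ of subsets of $X$ is $E$-disjoint if $(A\times B)\cap E=\emptyset$ whenever $A,B\in\mathcal{U}$, $A\ne B$. The family $\mathcal{U}$ is uniformly bounded if $\Delta_{\mathcal{U}}:=\bigcup_{U\in\mathcal{U}}(U\times U)\in\mathcal{E}$. Coarse property C: for any sequence $L_1\subseteq L_2\subseteq L_3\subseteq\cdots$ of entourages there are an $n$ and a finite sequence $\mathcal{U}^1,\ldots,\mathcal{U}^n$ of families of subsets of $X$ such that $\bigcup_{i=1}^n\mathcal{U}^i$ covers $X$, each $\mathcal{U}^i$ is uniformly bounded, and each $\mathcal{U}^i$ is $L_i$-disjoint. Coarse property A: for each $\varepsilon>0$ and each $E\in\mathcal{E}$ there is a map $a:X\to\ell^1(X)$, $x\mapsto a_x$, such that (1) $\|a_x\|_1=1$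 for all $x\in X$; (2) if $(x,y)\in E$ then $\|a_x-a_y\|_1<\varepsilon$; (3) there exists $S\in\mathcal{E}$ such that for each $x\in X$, $\operatorname{supp} a_x\subseteq S[x]$. Here $S[x]=S[\{x\}]=\{y\in X\mid (y,x)\in S\}$. *)

(* Defs.v *)
From mathcomp Require Import all_boot all_order all_algebra.
From mathcomp Require Import all_classical all_reals all_analysis.

Set Implicit Arguments.
Unset Strict Implicit.
Unset Printing Implicit Defensive.

Import Order.TTheory GRing.Theory Num.Theory.

Local Open Scope classical_set_scope.
Local Open Scope ring_scope.

(* The library composition [E1 \; E2] is
   {(x, z) | exists y, (x, y) \in E1 and (y, z) \in E2}. *)
Record coarse_structure (X : Type) (E : set (set (X * X))) : Prop := {
  coarse_sub : forall A B : set (X * X), A `<=` B -> E B -> E A ;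
  coarse_bigcup : forall F : set (set (X * X)),
    finite_set F -> F `<=` E -> E (\bigcup_(A in F) A) ;
  coarse_diagonal : E diagonal ;
  coarse_inv : forall A : set (X * X), E A -> E (A^-1)%relation ;
  coarse_comp : forall A B : set (X * X),
    E A -> E B -> E (A \; B)%relation }.

Definition entourage_disjoint (X : Type) (L : set (X * X)) (U : set (set X)) :=
  forall A B : set X, U A -> U B -> A <> B -> (A `*` B) `&` L = set0.

Definition uniformly_bounded (X : Type) (E : set (set (X * X)))
    (U : set (set X)) :=
  E (\bigcup_(A in U) (A `*` A)).

(* The sequences L and U are indexed from 0 instead of from 1. *)
Definition coarse_property_C (X : Type) (E : set (set (X * X))) :=
  forall L : nat -> set (X * X),
    (forall i, E (L i)) -> (forall i, L i `<=` L i.+1) ->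
    exists (n : nat) (U : 'I_n -> set (set X)),
      [/\ \bigcup_(A in \bigcup_(i in [set: 'I_n]) U i) A = [set: X],
          forall i : 'I_n, uniformly_bounded E (U i)
        & forall i : 'I_n, entourage_disjoint (L i) (U i)].

Definition l1norm (R : realType) (X : choiceType) (f : X -> R) : \bar R :=
  (\esum_(x in [set: X]) `|f x|%:E)%E.

Definition l1 (R : realType) (X : choiceType) : set (X -> R) :=
  [set f | (l1norm f < +oo)%E].

(* S[x] = {y | (y, x) \in S} is [ysection S x]. *)
Definition coarse_property_A (R : realType) (X : choiceType)
    (E : set (set (X * X))) :=
  forall (eps : R) (D : set (X * X)), 0 < eps -> E D ->
    exists a : X -> X -> R,
      [/\ forall x, l1 (a x),
          forall x, l1norm (a x) = 1%E,
          forall x y, D (x, y) -> (l1norm (a x \- a y)%R < eps%:E)%E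
        & exists2 S : set (X * X), E S &
            forall x, [set y | a x y != 0] `<=` ysection S x].

(* Main.v *)
(** Apply property C to the entourages L_i = D^(2 K_i + 1), with K_i growing
    geometrically.  Each family U_i carries a tent function phi_i: it is 1 on
    the union of U_i, drops by at most 1 / K_i per D-step, and vanishes outside
    the D^(K_i)-neighbourhood; L_i-disjointness makes the nearby member of U_i,
    hence a base point c_i(x) in it, the same for D-related points.  Starting
    from 0 and successively replacing b by phi_i delta_(c_i) + (1 - phi_i) b
    yields mass 1 as soon as some phi_i is 1, and each step increases the
    l^1-variation along D by at most 2 / K_i.  So the number of families, which
    is only known after the K_i are chosen, does not matter. *)

Require Import Defs.
From mathcomp Require Import all_boot all_order all_algebra.
From mathcomp Require Import all_classical all_reals all_analysis.
From mathcomp Require Import ring lra zify.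

Set Implicit Arguments.
Unset Strict Implicit.
Unset Printing Implicit Defensive.

Import Order.TTheory GRing.Theory Num.Theory.

Local Open Scope classical_set_scope.
Local Open Scope ring_scope.

(** * Sums and point masses in [l^1] *)

Lemma ge0_esumZl (R : realType) (T : choiceType) (I : set T) (a : T -> \bar R)
    (r : R) :
  (forall i, 0 <= a i)%E -> 0 <= r ->
  (\esum_(i in I) (r%:E * a i) = r%:E * \esum_(i in I) a i)%E.
Proof.
have esumZ_le (b : T -> \bar R) (t : R) : (forall i, 0 <= b i)%E ->
    0 <= t -> (\esum_(i in I) (t%:E * b i) <= t%:E * \esum_(i in I) b i)%E.
  move=> b0 t0; apply: ge_ereal_sup => _ [F [finF FI] <-].
  rewrite -ge0_mule_fsumr //; apply: lee_wpmul2l; first by rewrite lee_fin.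
  by apply: ereal_sup_ubound; exists F.
move=> a0 r0; apply/eqP; rewrite eq_le esumZ_le //=.
have [->|r_neq0] := eqVneq r 0.
  by rewrite mul0e; apply: esum_ge0 => i Ii; rewrite mul0e.
have r_gt0 : 0 < r by rewrite lt_def r_neq0.
(* The reverse inequality is [esumZ_le] for the terms [r%:E * a i] and the scalar [r^-1]. *)
rewrite -lee_pdivlMl //; apply: le_trans (esumZ_le _ _ _ _).
- by apply: le_esum => i Ii; rewrite muleA -EFinM mulVf // mul1e.
- by move=> i; apply: mule_ge0; rewrite ?lee_fin.
- by rewrite invr_ge0.
Qed.

Lemma l1norm_indicator (R : realType) (X : choiceType) (w : X) :
  (\esum_(z in [set: X]) ((z == w)%:R : R)%:E = 1)%E.
Proof.
rewrite -[RHS](@esum_set1 R X w (fun=> 1%E)) // [RHS]esum_mkcond.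
apply: eq_esum => z _.
have [->|zw] := eqVneq z w; first by rewrite mem_set.
by rewrite memNset //=; exact/eqP.
Qed.

(** * Iterated blending of point masses *)

(** Unrolled, index [i] contributes at [c i x] the weight [phi i x] times the product of
    [1 - phi j x] over [i < j < n]: later indices override earlier ones. *)
Fixpoint blend (R : realType) (X : choiceType) (phi : nat -> X -> R)
    (c : nat -> X -> X) (n : nat) (x y : X) : R :=
  if n is m.+1 then
    phi m x * (y == c m x)%:R + (1 - phi m x) * blend phi c m x y
  else 0.

Lemma blend_ge0 (R : realType) (X : choiceType) (phi : nat -> X -> R)
    (c : nat -> X -> X) n x y :
  (forall i x, 0 <= phi i x <= 1) -> 0 <= blend phi c n x y.
Proof.
move=> phi01; elim: n => //= m IH; have /andP[p0 p1] := phi01 m x.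
by rewrite addr_ge0 // mulr_ge0 // subr_ge0.
Qed.

(** Each blending step multiplies the mass still missing from 1 by [1 - phi m x], so a single factor
    0 gives norm 1. *)
Lemma l1norm_blend (R : realType) (X : choiceType) (phi : nat -> X -> R)
    (c : nat -> X -> X) n x :
  (forall i x, 0 <= phi i x <= 1) ->
  l1norm (blend phi c n x) = (1 - \prod_(i < n) (1 - phi i x))%:E.
Proof.
move=> phi01; elim: n => [|m IH].
  by rewrite big_ord0 subrr /l1norm; apply: esum1 => y _ /=; rewrite normr0.
have /andP[p0 p1] := phi01 m x.
rewrite /l1norm.
under eq_esum => y _.
  rewrite ger0_norm ?blend_ge0 //= EFinD !EFinM -[blend _ _ _ _ _]ger0_norm
    ?blend_ge0 //; over.
rewrite esumD; last 2 first.
- by move=> y _; rewrite -EFinM lee_fin mulr_ge0.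
- by move=> y _; rewrite -EFinM lee_fin mulr_ge0 // subr_ge0.
rewrite !ge0_esumZl ?subr_ge0 //.
rewrite l1norm_indicator [X in (_ + _ * X)%E]IH mule1 -EFinM -EFinD.
by rewrite big_ord_recr /=; congr EFin; ring.
Qed.

(** By induction, the difference splits into three terms: the new atoms, the old difference scaled
    by [1 - phi m x <= 1], and the change of that scale acting on the old blend. The first and third
    cost at most [e m] each, and earlier errors are never amplified. *)
Lemma l1norm_blendB (R : realType) (X : choiceType) (phi : nat -> X -> R)
    (c : nat -> X -> X) (e : nat -> R) n x y :
  (forall i x, 0 <= phi i x <= 1) ->
  (forall i, phi i x != 0 -> phi i y != 0 -> c i x = c i y) ->
  (forall i, `|phi i x - phi i y| <= e i) ->
  (l1norm (blend phi c n x \- blend phi c n y)%R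
     <= (\sum_(i < n) 2 * e i)%:E)%E.
Proof.
move=> phi01 cxy phixy; elim: n => [|m IH].
  rewrite big_ord0 /l1norm esum1 // => z _ /=.
  by rewrite subr0 normr0.
have /andP[p0 p1] := phi01 m x.
(* The two new atoms sit at a common point w, unless one has weight 0. *)
pose w := if phi m x == 0 then c m y else c m x.
have indE z : phi m x * (z == c m x)%:R - phi m y * (z == c m y)%:R
    = (phi m x - phi m y) * (z == w)%:R.
  rewrite /w; have [->|px] := eqVneq (phi m x) 0; first by ring.
  have [->|py] := eqVneq (phi m y) 0; first by ring.
  by rewrite cxy //; ring.
pose d := `|phi m x - phi m y|.
have d0 : 0 <= d by exact: normr_ge0.
apply: (@le_trans _ _ (\esum_(z in [set: X])
  (d%:E * ((z == w)%:R : R)%:E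
   + ((1 - phi m x)%:E * `|(blend phi c m x \- blend phi c m y) z|%:E
      + d%:E * `|blend phi c m y z|%:E)))%E).
  apply: le_esum => z _; rewrite -!EFinM -!EFinD lee_fin /=.
  have -> : phi m x * (z == c m x)%:R + (1 - phi m x) * blend phi c m x z
      - (phi m y * (z == c m y)%:R + (1 - phi m y) * blend phi c m y z)
      = (phi m x - phi m y) * (z == w)%:R
        + ((1 - phi m x) * (blend phi c m x z - blend phi c m y z)
           + - (phi m x - phi m y) * blend phi c m y z).
    by rewrite -indE; ring.
  apply: le_trans (ler_normD _ _) _; apply: lerD.
    by rewrite normrM (ger0_norm (ler0n _ _)).
  apply: le_trans (ler_normD _ _) _; apply: lerD.
    by rewrite normrM ger0_norm // subr_ge0.
  by rewrite normrM normrN.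
rewrite esumD; last 2 first.
- by move=> z _; rewrite -EFinM lee_fin mulr_ge0.
- move=> z _; rewrite -!EFinM -EFinD lee_fin addr_ge0 // mulr_ge0 //.
  by rewrite subr_ge0.
rewrite esumD; last 2 first.
- by move=> z _; rewrite -EFinM lee_fin mulr_ge0 // subr_ge0.
- by move=> z _; rewrite -EFinM lee_fin mulr_ge0.
rewrite !ge0_esumZl ?subr_ge0 //.
rewrite l1norm_indicator -!/(l1norm _) l1norm_blend // mule1.
have -> : \sum_(i < m.+1) 2 * e i = e m + (\sum_(i < m) 2 * e i + e m).
  by rewrite big_ord_recr /=; ring.
rewrite !EFinD.
(* This caps the mass of [blend phi c m y] at 1, which bounds the third term by [e m]. *)
have P0 : 0 <= \prod_(i < m) (1 - phi i y).
  by apply: prodr_ge0 => i _; rewrite subr_ge0; have /andP[] := phi01 i y.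
apply: leeD; first by rewrite lee_fin; exact: phixy.
apply: leeD; last first.
  by rewrite -EFinM lee_fin; apply: le_trans (phixy m); rewrite ler_piMr //; lra.
apply: le_trans IH; rewrite -[leRHS]mul1e; apply: lee_wpmul2r.
  by apply: esum_ge0 => z _; rewrite lee_fin.
by rewrite lee_fin; lra.
Qed.

Lemma blend_neq0 (R : realType) (X : choiceType) (phi : nat -> X -> R)
    (c : nat -> X -> X) n x y :
  blend phi c n x y != 0 ->
  exists i, [/\ (i < n)%N, phi i x != 0 & y = c i x].
Proof.
elim: n => [|m IH] /=; first by rewrite eqxx.
have [p0|pn0] := eqVneq (phi m x) 0; last have [yc|_] := eqVneq y (c m x).
- rewrite p0 mul0r add0r subr0 mul1r => /IH[i [im pi yi]].
  by exists i; split => //; exact: ltnW.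
- by move=> _; exists m.
rewrite mulr0 add0r mulf_eq0 negb_or => /andP[_ /IH[i [im pi yi]]].
by exists i; split => //; exact: ltnW.
Qed.

(** * Powers of a relation *)

(* Pitfall: in the library, [B \; A] relates x to z when A (x, y) and B (y, z)
   for some y. *)
Fixpoint relpow (X : Type) (D : set (X * X)) (k : nat) : set (X * X) :=
  if k is m.+1 then (D \; relpow D m)%relation else diagonal.

Lemma relpow_entourage (X : Type) (E : set (set (X * X))) D k :
  coarse_structure E -> E D -> E (relpow D k).
Proof.
move=> cE ED; elim: k => [|k IH] /=; first exact: (coarse_diagonal cE).
exact: (coarse_comp cE).
Qed.

Lemma relpowD (X : Type) (D : set (X * X)) k m x y z :
  relpow D k (x, y) -> relpow D m (y, z) -> relpow D (k + m) (x, z).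
Proof.
move=> Dxy; elim: m z => [|m IH] z /=; first by move=> /diagonalP <-; rewrite addn0.
by move=> [t yt tz]; rewrite addnS; exists t => //=; exact: IH.
Qed.

Lemma relpow1 (X : Type) (D : set (X * X)) x y : D (x, y) -> relpow D 1 (x, y).
Proof. by move=> Dxy; exists x. Qed.

Lemma relpow_sym (X : Type) (D : set (X * X)) k x y :
  (forall x y, D (x, y) -> D (y, x)) -> relpow D k (x, y) -> relpow D k (y, x).
Proof.
move=> Dsym; elim: k x y => [|k IH] x y; first by move=> /diagonalP ->.
move=> [t /IH xt /Dsym ty]; rewrite -add1n.
exact: relpowD (relpow1 ty) xt.
Qed.

Lemma subset_relpow (X : Type) (D : set (X * X)) k m :
  (forall x, D (x, x)) -> (k <= m)%N -> relpow D k `<=` relpow D m.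
Proof.
move=> Drefl km [x y]; rewrite -(subnKC km); elim: (m - k)%N => [|j IH] Dxy.
  by rewrite addn0.
by rewrite addnS; exists y => //=; exact: IH.
Qed.

(** * Tent functions and base points *)

(** Each base point is chosen from a set attached to [x], with [x] itself as default; this lets two
    points with the same set share it. *)
Lemma xget_default (T : choiceType) (x y : T) (P : set T) :
  P !=set0 -> xget x P = xget y P.
Proof.
move=> [z Pz]; rewrite /xget; case: pselect => // -[].
by exists z; apply/asboolP.
Qed.

(** The shift pairs [P k] with [Q k.+1]; only the last term of [P] stays unpaired. A [D]-step shifts
    path lengths in this way. *)
Lemma sum_shift_le (P Q : nat -> bool) (n : nat) :
  (forall k, P k -> Q k.+1) ->
  (\sum_(k < n) P k <= (\sum_(k < n) Q k).+1)%N.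
Proof.
move=> PQ; case: n => [|n]; first by rewrite !big_ord0.
rewrite big_ord_recr [X in (_ <= X.+1)%N]big_ord_recl /=.
have : (\sum_(i < n) P i <= \sum_(i < n) Q i.+1)%N.
  by apply: leq_sum => i _; move: (PQ i); case: (P i) => // ->.
by move=> PQs; rewrite addnC -addSn; apply: leq_add => //; case: (P n).
Qed.

(** The tent and its base points form one pair so that a single use of [choice] selects both for all
    indices. *)
Lemma tent_function (R : realType) (X : choiceType) (D : set (X * X))
    (K : nat) (U : set (set X)) :
  (forall x, D (x, x)) -> (forall x y, D (x, y) -> D (y, x)) -> (0 < K)%N ->
  entourage_disjoint (relpow D (K + K).+1) U ->
  exists pc : (X -> R) * (X -> X),
    [/\ forall x, 0 <= pc.1 x <= 1,
        forall A x, U A -> A x -> pc.1 x = 1,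
        forall x, pc.1 x != 0 ->
          (relpow D K \; \bigcup_(A in U) (A `*` A))%relation (pc.2 x, x),
        forall x y, D (x, y) -> pc.1 x != 0 -> pc.1 y != 0 -> pc.2 x = pc.2 y
      & forall x y, D (x, y) -> `|pc.1 x - pc.1 y| <= K%:R^-1].
Proof.
move=> Drefl Dsym K0 Udisj.
(* If [d] is the least number of [D]-steps from the union of [U] to [x], then [near k x] means
   [d <= k], so the count [N x] is [K - d] truncated at 0. *)
pose near k x := `[< exists A u, [/\ U A, A u & relpow D k (u, x)] >].
pose N x := (\sum_(k < K) near k x)%N.
pose phi x : R := (N x)%:R / K%:R.
(* By disjointness at most one member of [U] lies within [K] steps of [x]. Choosing from the set
   [G x], not from a witness, makes the base points of related points agree. *)
pose G x := [set z | exists A u, [/\ U A, A u, relpow D K (u, x) & A z]].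
have KR0 : 0 < K%:R :> R by rewrite ltr0n.
have phi_near x : phi x != 0 -> exists A u, [/\ U A, A u & relpow D K (u, x)].
  rewrite mulf_eq0 negb_or => /andP[+ _]; rewrite pnatr_eq0 sum_nat_eq0 negb_forall.
  move=> /existsP[k]; rewrite /= eqb0 negbK => /asboolP[A [u [UA Au ux]]].
  by exists A, u; split => //; apply: subset_relpow ux => //; exact: ltnW.
have G_neq0 x : phi x != 0 -> G x !=set0.
  by move=> /phi_near[A [u [UA Au ux]]]; exists u, A, u.
have G_sub x y : D (x, y) -> phi y != 0 -> G x `<=` G y.
  move=> Dxy /phi_near[B [v [UB Bv vy]]] z [A [u [UA Au ux Az]]].
  have [AB|/(Udisj _ _ UA UB)] := pselect (A = B).
    by exists B, v; split => //; rewrite -AB.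
  rewrite -subset0 => /(_ (u, v))[]; split => //.
  (* The path from [u] to [x], then to [y], then back to [v] has [K + 1 + K] steps. *)
  rewrite -addSn -addn1; apply: relpowD (relpow_sym Dsym vy).
  exact: relpowD (relpow1 Dxy).
have N_le x y : D (x, y) -> (N x <= (N y).+1)%N.
  move=> Dxy; apply: (@sum_shift_le (near^~ x) (near^~ y)) => k /asboolP[A [u [UA Au ux]]].
  by apply/asboolP; exists A, u; split => //; exists x.
have phi_le x y : D (x, y) -> phi x - phi y <= K%:R^-1.
  move=> Dxy; rewrite -mulrBl ler_piMl ?invr_ge0 ?ler0n //.
  by rewrite lerBlDl natr1 ler_nat N_le.
exists (phi, fun x => xget x (G x)); split => /=.
- move=> x; rewrite divr_ge0 // ler_pdivrMr // mul1r ler_nat.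
  by rewrite -[leqRHS]card_ord -sum1_card leq_sum // => k _; case: (near _ _).
- move=> A x UA Ax; rewrite /phi (_ : N x = K) ?divff ?gt_eqF //.
  rewrite -[RHS]card_ord -sum1_card; apply: eq_bigr => k _.
  rewrite (_ : near k x = true) //; apply/asboolP; exists A, x; split => //.
  exact: (@subset_relpow _ _ 0).
- move=> x /G_neq0 /(xgetPex x)[A [u [UA Au ux Ag]]].
  by exists u => //; exists A.
- move=> x y Dxy px py.
  have GE : G x = G y.
    by apply/seteqP; split; apply: G_sub => //; exact: Dsym.
  by rewrite GE; apply: xget_default; exact: G_neq0.
- move=> x y Dxy; rewrite ler_norml phi_le // andbT lerNl opprB phi_le //.
  exact: Dsym.
Qed.

(** * Entourages, property C and the conclusion *)

Lemma coarse_setU (X : Type) (E : set (set (X * X))) A B :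
  coarse_structure E -> E A -> E B -> E (A `|` B).
Proof.
move=> cE EA EB; 
have -> : A `|` B = \bigcup_(C in [set A; B]) C.
  by rewrite bigcup_setU !bigcup_set1.
by apply: (coarse_bigcup cE) => // _ [->|->].
Qed.

(** Padding with empty families past [n] is harmless: they are vacuously disjoint, and the empty set
    is an entourage. Tents can then be chosen for every natural index. *)
Lemma coarse_property_C_nat (X : Type) (E : set (set (X * X)))
    (L : nat -> set (X * X)) :
  coarse_structure E -> coarse_property_C E ->
  (forall i, E (L i)) -> (forall i, L i `<=` L i.+1) ->
  exists (n : nat) (U : nat -> set (set X)),
    [/\ forall x, exists i A, [/\ (i < n)%N, U i A & A x],
        forall i, uniformly_bounded E (U i)
      & forall i, entourage_disjoint (L i) (U i)].
Proof.
move=> cE CE EL Lmono; have [n [U [Ucov Ubd Udisj]]] := CE L EL Lmono.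
exists n, (fun i => if insub i is Some j then U j else set0); split.
- move=> x; have : [set: X] x by [].
  rewrite -Ucov => -[A [j _ UA] Ax]; exists j, A; split => //.
  by rewrite valK.
- move=> i; case: insubP => [j _ _|_]; first exact: Ubd.
  rewrite /uniformly_bounded bigcup_set0.
  by apply: (coarse_sub cE) (coarse_diagonal cE).
- by move=> i; case: insubP => [j _ <-|_] //; exact: Udisj.
Qed.

Lemma coarse_bigcup_ord (X : Type) (E : set (set (X * X)))
    (S : nat -> set (X * X)) n :
  coarse_structure E -> (forall i, E (S i)) -> E (\bigcup_(i in `I_n) S i).
Proof.
move=> cE ES; rewrite -(bigcup_image `I_n S id); apply: (coarse_bigcup cE).
  by apply: finite_image; exact: finite_II.
by move=> _ [i _ <-].
Qed.

Theorem theorem3p10 (R : realType) (X : choiceType) (E : set (set (X * X))) :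
  coarse_structure E -> coarse_property_C E -> coarse_property_A R E.
Proof.
move=> cE CE eps D0 eps0 ED0.
(* Reflexivity makes the powers of [D] increase, and symmetry makes paths reversible. *)
pose D := (D0 `|` D0^-1%relation) `|` diagonal.
have ED : E D.
  apply: (coarse_setU cE) (coarse_diagonal cE).
  exact: (coarse_setU cE) (coarse_inv cE _).
have Drefl x : D (x, x) by right.
have Dsym x y : D (x, y) -> D (y, x).
  by move=> [[|]|/diagonalP ->]; [left; right|left; left|right].
(* This gives [4 / M < eps], and the terms [2 / (2 ^ i * M)] sum to less than [4 / M] however many
   families there are. *)
pose M := (Num.truncn (4 / eps)).+1.
have M_gt : 4 / eps < M%:R by exact: truncnS_gt.
pose K i := (2 ^ i * M)%N.
have K_gt0 i : (0 < K i)%N by rewrite muln_gt0 expn_gt0.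
pose L i := relpow D (K i + K i).+1.
have L_mono i : L i `<=` L i.+1.
  by apply: subset_relpow => //; rewrite /K expnS; lia.
have [n [U [Ucov Ubd Udisj]]] := coarse_property_C_nat cE CE
  (fun i => relpow_entourage _ cE ED) L_mono.
have [pc pcP] := choice (fun i => tent_function R Drefl Dsym (K_gt0 i) (Udisj i)).
pose phi i := (pc i).1; pose c i := (pc i).2.
have phi01 i x : 0 <= phi i x <= 1 by have [/(_ x)] := pcP i.
have norm1 x : l1norm (blend phi c n x) = 1%E.
  rewrite l1norm_blend //; have [i [A [ltin UA Ax]]] := Ucov x.
  have phi1 : phi i x = 1 by have [_ /(_ A x UA Ax)] := pcP i.
  by rewrite (bigD1 (Ordinal ltin)) //= phi1 subrr mul0r subr0.
have sumE m : \sum_(i < m) 2 * (K i)%:R^-1 = 4 / M%:R * (1 - 2 ^- m) :> R.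
  elim: m => [|m IH]; first by rewrite big_ord0 expr0 invr1 subrr mulr0.
  rewrite big_ord_recr IH /= /K natrM natrX exprS; field.
  by rewrite expf_neq0 // pnatr_eq0.
exists (blend phi c n); split => //.
- by move=> x; rewrite /l1 /= norm1 ltry.
- move=> x y D0xy; have Dxy : D (x, y) by left; left.
  apply: le_lt_trans (l1norm_blendB (e := fun i => (K i)%:R^-1) n phi01 _ _) _.
  + by move=> i px py; have [_ _ _ /(_ x y Dxy px py)] := pcP i.
  + by move=> i; have [_ _ _ _ /(_ x y Dxy)] := pcP i.
  rewrite lte_fin sumE; apply: (@le_lt_trans _ _ (4 / M%:R)).
    by rewrite ler_piMr ?divr_ge0 // lerBlDr lerDl invr_ge0 exprn_ge0.
  by rewrite ltr_pdivrMr ?ltr0n // mulrC -ltr_pdivrMr.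
(* Each atom [c i x] with [phi i x != 0] shares a member of [U i] with a point from which [K i]
   steps lead to [x]. *)
- exists (\bigcup_(i in `I_n)
    (relpow D (K i) \; \bigcup_(A in U i) (A `*` A))%relation).
    apply: coarse_bigcup_ord => // i; apply: (coarse_comp cE) => //; last exact: Ubd.
    exact: relpow_entourage.
  move=> x y /blend_neq0[i [ltin px ->]]; rewrite /ysection /= inE.
  by exists i => //; have [_ _ /(_ x px)] := pcP i.
Qed.
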